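(* The covariant functors $F:\mathbf{SP}\to\mathbf{Cls}$ and $G:\mathbf{Cls}\to\mathbf{SP}$ restrict and corestrict to functors $F:\mathbf{SP}_0\to\mathbf{Cls}_0$ and $G:\mathbf{Cls}_0\to\mathbf{SP}_0$, which establish an equivalence of categories between $\mathbf{SP}_0$ and $\mathbf{Cls}_0$.
   Context: All orders written $<$ are reflexive (non-strict). A state property system $(\Sigma,\mathcal L,\xi)$ consists of a pre-ordered set $(\Sigma,<)$, a complete lattice $(\mathcal L,<,\wedge,\vee)$ with maximal element $I$ and minimal element $0$, and a function $\xi:\Sigma\to\mathcal P(\mathcal L)$ such that for all $p\in\Sigma$ and all families $(a_i)_i$ in $\mathcal L$: $I\in\xi(p)$; $0\notin\xi(p)$; ($a_i\in\xi(p)$ for all $i$) $\Leftrightarrow$ $\wedge_i a_i\in\xi(p)$; and for $p,q\in\Sigma$, $a,b\in\mathcal L$: $p<q\Leftrightarrow\xi(q)\subset\xi(p)$; $a<b\Leftrightarrow$ (for all $r\in\Sigma$, $a\in\xi(r)$ implies $b\in\xi(r)$). A morphism $(m,n):(\Sigma',\mathcal L',\xi')\to(\Sigma,\mathcal L,\xi)$ of state property systems is a pair of functions $m:\Sigma'\to\Sigma$, $n:\mathcal L\to\mathcal L'$ such that for all $a\in\mathcal L$, $p'\in\Sigma'$: $a\in\xi(m(p'))\Leftrightarrow n(a)\in\xi'(p')$. Composition is $(m_2,n_2)\circ(m_1,n_1)=(m_2\circ m_1,n_1\circ n_2)$, with identities $(\mathrm{id}_\Sigma,\mathrm{id}_{\mathcal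 L})$. This is the category $\mathbf{SP}$. $\mathbf{SP}_0$ is the full subcategory of $\mathbf{SP}$ whose objects are the state property systems with $\xi$ injective. A closure space $(Z,\mathcal G)$ is a set $Z$ with $\mathcal G\subset\mathcal P(Z)$ such that $Z,\emptyset\in\mathcal G$ and $\mathcal G$ is closed under arbitrary intersections; elements of $\mathcal G$ are the closed sets, $cl(Y)=\bigcap\{G\in\mathcal G\mid Y\subset G\}$, and a map is continuous if preimages of closed sets are closed. $\mathbf{Cls}$ is the category of closure spaces and continuous maps. A closure space is $T_0$ if $cl(\{x\})=cl(\{y\})$ implies $x=y$; $\mathbf{Cls}_0$ is the category of $T_0$ closure spaces and continuous maps. The functor $F$: $F(\Sigma,\mathcal L,\xi)=(\Sigma,\kappa(\mathcal L))$, where $\kappa(a)=\{p\in\Sigma\mid a\in\xi(p)\}$ for $a\in\mathcal L$ and $\kappa(\mathcal L)=\{\kappa(a)\mid a\in\mathcal L\}$; $F(m,n)=m$. The functor $G$: $G(\Sigma,\mathcal F)=(\Sigma,\mathcal F,\xi)$ where $\mathcal F$ is ordered by inclusion with $\wedge_iF_i=\bigcap_iF_i$, $\vee_iF_i=cl(\bigcup_iF_i)$, $\xi(p)=\{F\in\mathcal F\mid p\in F\}$, and $p<q\Leftrightarrow\xi(q)\subset\xi(p)$ on $\Sigma$; $G(m)=(m,m^{-1})$, with $m^{-1}$ the preimage map on closed sets. *)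

(* Defs.v *)
From Stdlib Require Import Relation_Definitions.
From mathcomp Require Import ssreflect ssrfun ssrbool.
From mathcomp Require Import boolp classical_sets.

Set Implicit Arguments.
Unset Strict Implicit.
Unset Printing Implicit Defensive.

Local Open Scope classical_set_scope.

Record category := Category {
  obj :> Type;
  hom : obj -> obj -> Type;
  idm : forall X, hom X X;
  comp : forall X Y Z, hom Y Z -> hom X Y -> hom X Z;
  comp_idl : forall X Y (f : hom X Y), comp (idm Y) f = f;
  comp_idr : forall X Y (f : hom X Y), comp f (idm X) = f;
  compA : forall X Y Z W (h : hom Z W) (g : hom Y Z) (f : hom X Y),
    comp h (comp g f) = comp (comp h g) f
}.
Arguments hom {c} X Y : rename.
Arguments idm {c} X : rename.
Arguments comp {c X Y Z} g f : rename.

Record functor (C D : category) := Functor {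
  fobj :> C -> D;
  fmap : forall X Y : C, hom X Y -> hom (fobj X) (fobj Y);
  fmap_id : forall X : C, fmap (idm X) = idm (fobj X);
  fmap_comp : forall (X Y Z : C) (g : hom Y Z) (f : hom X Y),
    fmap (comp g f) = comp (fmap g) (fmap f)
}.
Arguments fmap {C D} f {X Y} _ : rename.

Definition id_functor (C : category) : functor C C :=
  @Functor C C (fun X => X) (fun _ _ f => f)
    (fun _ => erefl) (fun _ _ _ _ _ => erefl).

Section CompFunctor.
Variables (C D E : category) (G : functor D E) (F : functor C D).

Lemma comp_fmap_id (X : C) : fmap G (fmap F (idm X)) = idm (G (F X)).
Proof. by rewrite !fmap_id. Qed.

Lemma comp_fmap_comp (X Y Z : C) (g : hom Y Z) (f : hom X Y) :
  fmap G (fmap F (comp g f)) =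
  comp (fmap G (fmap F g)) (fmap G (fmap F f)).
Proof. by rewrite !fmap_comp. Qed.

Definition comp_functor : functor C E :=
  @Functor C E (fun X => G (F X)) (fun _ _ f => fmap G (fmap F f))
    comp_fmap_id comp_fmap_comp.
End CompFunctor.

Definition is_iso (C : category) (X Y : C) (f : hom X Y) : Prop :=
  exists g : hom Y X, comp g f = idm X /\ comp f g = idm Y.

Record natural_transformation (C D : category) (F G : functor C D) :=
  NaturalTransformation {
    component :> forall X : C, hom (F X) (G X);
    naturality : forall (X Y : C) (f : hom X Y),
      comp (component Y) (fmap F f) = comp (fmap G f) (component X)
  }.

Definition naturally_isomorphic (C D : category) (F G : functor C D) : Prop :=
  exists t : natural_transformation F G, forall X : C, is_iso (t X).

Definition establish_equivalence (C D : category)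
    (F : functor C D) (G : functor D C) : Prop :=
  naturally_isomorphic (id_functor C) (comp_functor G F) /\
  naturally_isomorphic (comp_functor F G) (id_functor D).

Definition full_subcategory (C : category) (P : C -> Prop) : category :=
  @Category {X : C | P X} (fun X Y => hom (sval X) (sval Y))
    (fun X => idm (sval X)) (fun _ _ _ g f => comp g f)
    (fun _ _ f => comp_idl f) (fun _ _ f => comp_idr f)
    (fun _ _ _ _ h g f => compA h g f).

Definition restrict_functor (C D : category) (P : C -> Prop) (Q : D -> Prop)
    (F : functor C D) (FPQ : forall X : C, P X -> Q (F X)) :
    functor (full_subcategory P) (full_subcategory Q) :=
  @Functor (full_subcategory P) (full_subcategory Q)
    (fun X => exist Q (F (sval X)) (FPQ (sval X) (svalP X)))
    (fun _ _ f => fmap F f)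
    (fun X => fmap_id F (sval X)) (fun _ _ _ g f => fmap_comp F g f).

(* The infimum and supremum of a family [a] are [meet (range a)] and
   [join (range a)]. *)
Record complete_lattice := CompleteLattice {
  carrier :> Type;
  le : relation carrier;
  meet : set carrier -> carrier;
  join : set carrier -> carrier;
  top : carrier;
  bot : carrier;
  le_order : order carrier le;
  meet_lb : forall (A : set carrier) a, A a -> le (meet A) a;
  meet_glb : forall (A : set carrier) b,
    (forall a, A a -> le b a) -> le b (meet A);
  join_ub : forall (A : set carrier) a, A a -> le a (join A);
  join_lub : forall (A : set carrier) b,
    (forall a, A a -> le a b) -> le (join A) b;
  le_top : forall a, le a top;
  le_bot : forall a, le bot a
}.
Arguments le {c} _ _ : rename.
Arguments meet {c} A : rename.
Arguments join {c} A : rename.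
Arguments top {c} : rename.
Arguments bot {c} : rename.

Record state_property_system := StatePropertySystem {
  state :> Type;
  state_le : relation state;
  property : complete_lattice;
  xi : state -> set property;
  state_le_preorder : preorder state state_le;
  xi_top : forall p, xi p top;
  xi_bot : forall p, ~ xi p bot;
  xi_meet : forall p (J : Type) (a : J -> property),
    (forall i, xi p (a i)) <-> xi p (meet (range a));
  state_leE : forall p q, state_le p q <-> xi q `<=` xi p;
  property_leE : forall a b : property,
    le a b <-> (forall r, xi r a -> xi r b)
}.
Arguments property : clear implicits.
Arguments xi {s} p _ : rename.

Record sp_morphism (S' S : state_property_system) := SPMorphism {
  sp_m : S' -> S;
  sp_n : property S -> property S';
  sp_mn : forall (a : property S) (p' : S'),
    xi (sp_m p') a <-> xi p' (sp_n a)
}.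

Lemma sp_morphism_eq (S' S : state_property_system) (f g : sp_morphism S' S) :
  sp_m f = sp_m g -> sp_n f = sp_n g -> f = g.
Proof.
case: f g => [m n mn] [m' n' mn'] /= em en; subst m' n'.
by congr SPMorphism; exact: Prop_irrelevance.
Qed.

Definition sp_id (S : state_property_system) : sp_morphism S S :=
  @SPMorphism S S id id (fun _ _ => iff_refl _).

Lemma sp_comp_subproof (S1 S2 S3 : state_property_system)
    (g : sp_morphism S2 S3) (f : sp_morphism S1 S2)
    (a : property S3) (p : S1) :
  xi ((sp_m g \o sp_m f) p) a <-> xi p ((sp_n f \o sp_n g) a).
Proof. exact: iff_trans (sp_mn g a (sp_m f p)) (sp_mn f (sp_n g a) p). Qed.

Definition sp_comp (S1 S2 S3 : state_property_system)
    (g : sp_morphism S2 S3) (f : sp_morphism S1 S2) : sp_morphism S1 S3 :=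
  @SPMorphism S1 S3 (sp_m g \o sp_m f) (sp_n f \o sp_n g)
    (sp_comp_subproof g f).

Lemma sp_comp_idl (X Y : state_property_system) (f : sp_morphism X Y) :
  sp_comp (sp_id Y) f = f.
Proof. exact: sp_morphism_eq. Qed.

Lemma sp_comp_idr (X Y : state_property_system) (f : sp_morphism X Y) :
  sp_comp f (sp_id X) = f.
Proof. exact: sp_morphism_eq. Qed.

Lemma sp_compA (X Y Z W : state_property_system)
    (h : sp_morphism Z W) (g : sp_morphism Y Z) (f : sp_morphism X Y) :
  sp_comp h (sp_comp g f) = sp_comp (sp_comp h g) f.
Proof. exact: sp_morphism_eq. Qed.

Definition SP : category :=
  @Category state_property_system sp_morphism sp_id sp_comp
    sp_comp_idl sp_comp_idr sp_compA.

Definition xi_injective (S : state_property_system) : Prop :=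
  injective (@xi S).

Definition SP0 : category := full_subcategory (C := SP) xi_injective.

Record closure_space := ClosureSpace {
  point :> Type;
  closed_set : set (set point);
  closedT : closed_set setT;
  closed0 : closed_set set0;
  closed_bigcap : forall S : set (set point),
    S `<=` closed_set -> closed_set (\bigcap_(A in S) A)
}.
Arguments closed_set : clear implicits.

Definition cl (Z : closure_space) (Y : set Z) : set Z :=
  \bigcap_(A in [set A | closed_set Z A /\ Y `<=` A]) A.

Record continuous_map (Z' Z : closure_space) := ContinuousMap {
  cm_fun :> Z' -> Z;
  cm_continuous : forall A, closed_set Z A -> closed_set Z' (cm_fun @^-1` A)
}.

Lemma continuous_map_eq (Z' Z : closure_space) (f g : continuous_map Z' Z) :
  cm_fun f = cm_fun g -> f = g.
Proof.
case: f g => [f cf] [g cg] /= e; subst g.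
by congr ContinuousMap; exact: Prop_irrelevance.
Qed.

Definition cm_id (Z : closure_space) : continuous_map Z Z :=
  @ContinuousMap Z Z id (fun _ cA => cA).

Definition cm_comp (Z1 Z2 Z3 : closure_space)
    (g : continuous_map Z2 Z3) (f : continuous_map Z1 Z2) :
    continuous_map Z1 Z3 :=
  @ContinuousMap Z1 Z3 (g \o f)
    (fun A cA => cm_continuous f (cm_continuous g cA)).

Lemma cm_comp_idl (X Y : closure_space) (f : continuous_map X Y) :
  cm_comp (cm_id Y) f = f.
Proof. exact: continuous_map_eq. Qed.

Lemma cm_comp_idr (X Y : closure_space) (f : continuous_map X Y) :
  cm_comp f (cm_id X) = f.
Proof. exact: continuous_map_eq. Qed.

Lemma cm_compA (X Y Z W : closure_space) (h : continuous_map Z W)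
    (g : continuous_map Y Z) (f : continuous_map X Y) :
  cm_comp h (cm_comp g f) = cm_comp (cm_comp h g) f.
Proof. exact: continuous_map_eq. Qed.

Definition Cls : category :=
  @Category closure_space continuous_map cm_id cm_comp
    cm_comp_idl cm_comp_idr cm_compA.

Definition T0 (Z : closure_space) : Prop :=
  forall x y : Z, cl [set x] = cl [set y] -> x = y.

Definition Cls0 : category := full_subcategory (C := Cls) T0.

Section FObj.
Variable S : state_property_system.

Definition kappa (a : property S) : set S := [set p | xi p a].

Lemma kappa_top : kappa top = setT.
Proof. by apply/seteqP; split => // p _; exact: xi_top. Qed.

Lemma kappa_bot : kappa bot = set0.
Proof. by apply/seteqP; split => // p; exact: xi_bot. Qed.

Lemma kappa_meet (J : Type) (a : J -> property S) :
  kappa (meet (range a)) = \bigcap_i kappa (a i).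
Proof.
apply/seteqP; split => p.
- by move=> pm i _; move: i; apply/xi_meet.
- by move=> pa; apply/xi_meet => i; exact: pa.
Qed.

Lemma kappa_closedT : range kappa setT.
Proof. by exists top => //; exact: kappa_top. Qed.

Lemma kappa_closed0 : range kappa set0.
Proof. by exists bot => //; exact: kappa_bot. Qed.

Lemma kappa_closed_bigcap (T : set (set S)) :
  T `<=` range kappa -> range kappa (\bigcap_(A in T) A).
Proof.
move=> Tk; pose a (i : {a | T (kappa a)}) := sval i.
exists (meet (range a)) => //; rewrite kappa_meet.
apply/seteqP; split => p pT.
- by move=> A TA; case: (Tk A TA) => b _ kb; subst A;
    exact: (pT (exist _ b TA)).
- by move=> [b Tb] _; exact: pT Tb.
Qed.

Definition F_obj : closure_space :=
  @ClosureSpace S (range kappa)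
    kappa_closedT kappa_closed0 kappa_closed_bigcap.
End FObj.

Lemma F_map_subproof (S' S : state_property_system) (f : sp_morphism S' S)
    (A : set S) :
  closed_set (F_obj S) A -> closed_set (F_obj S') (sp_m f @^-1` A).
Proof.
case=> a _ <-; exists (sp_n f a) => //.
by apply/seteqP; split => p /= h; apply/(sp_mn f).
Qed.

Definition F_map (S' S : state_property_system) (f : sp_morphism S' S) :
    continuous_map (F_obj S') (F_obj S) :=
  @ContinuousMap (F_obj S') (F_obj S) (sp_m f) (F_map_subproof f).

Lemma F_map_id (S : state_property_system) : F_map (sp_id S) = cm_id (F_obj S).
Proof. exact: continuous_map_eq. Qed.

Lemma F_map_comp (X Y Z : state_property_system)
    (g : sp_morphism Y Z) (f : sp_morphism X Y) :
  F_map (sp_comp g f) = cm_comp (F_map g) (F_map f).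
Proof. exact: continuous_map_eq. Qed.

Definition F : functor SP Cls := @Functor SP Cls F_obj F_map F_map_id F_map_comp.

Section GObj.
Variable Z : closure_space.

Definition closed_subset := {A : set Z | closed_set Z A}.

Lemma closed_subset_eq (A B : closed_subset) : sval A = sval B -> A = B.
Proof.
case: A B => [A cA] [B cB] /= e; subst B.
by congr exist; exact: Prop_irrelevance.
Qed.

Definition closed_le (A B : closed_subset) : Prop := sval A `<=` sval B.

Lemma closed_le_order : order closed_subset closed_le.
Proof.
split.
- by move=> A.
- by move=> A B C; exact: subset_trans.
- by move=> A B AB BA; apply/closed_subset_eq/seteqP.
Qed.

Lemma closed_meet_subproof (T : set closed_subset) :
  closed_set Z (\bigcap_(A in T) sval A).
Proof.
rewrite -[X in closed_set Z X](bigcap_image T (fun A => sval A) id).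
by apply: closed_bigcap => _ [A _ <-]; exact: svalP.
Qed.

Definition closed_meet (T : set closed_subset) : closed_subset :=
  exist _ (\bigcap_(A in T) sval A) (closed_meet_subproof T).

Lemma cl_closed (Y : set Z) : closed_set Z (cl Y).
Proof. by apply: closed_bigcap => A []. Qed.

Lemma sub_cl (Y : set Z) : Y `<=` cl Y.
Proof. by move=> x Yx A [_]; exact. Qed.

Lemma cl_min (Y A : set Z) : closed_set Z A -> Y `<=` A -> cl Y `<=` A.
Proof. by move=> cA YA x; apply. Qed.

Definition closed_join (T : set closed_subset) : closed_subset :=
  exist _ (cl (\bigcup_(A in T) sval A)) (cl_closed _).

Definition closed_top : closed_subset := exist _ setT (closedT Z).
Definition closed_bot : closed_subset := exist _ set0 (closed0 Z).

Lemma closed_meet_lb (T : set closed_subset) A :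
  T A -> closed_le (closed_meet T) A.
Proof. by move=> TA x; apply. Qed.

Lemma closed_meet_glb (T : set closed_subset) B :
  (forall A, T A -> closed_le B A) -> closed_le B (closed_meet T).
Proof. by move=> BT x Bx A TA; exact: BT Bx. Qed.

Lemma closed_join_ub (T : set closed_subset) A :
  T A -> closed_le A (closed_join T).
Proof. by move=> TA x Ax; apply: sub_cl; exists A. Qed.

Lemma closed_join_lub (T : set closed_subset) B :
  (forall A, T A -> closed_le A B) -> closed_le (closed_join T) B.
Proof.
by move=> TB; apply: cl_min (svalP B) _ => x [A TA Ax]; exact: TB Ax.
Qed.

Lemma closed_le_top A : closed_le A closed_top.
Proof. by []. Qed.

Lemma closed_le_bot A : closed_le closed_bot A.
Proof. by []. Qed.

Definition closed_lattice : complete_lattice :=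
  @CompleteLattice closed_subset closed_le closed_meet closed_join
    closed_top closed_bot closed_le_order closed_meet_lb closed_meet_glb
    closed_join_ub closed_join_lub closed_le_top closed_le_bot.

Definition G_xi (p : Z) : set closed_lattice := [set A | sval A p].

Definition G_state_le (p q : Z) : Prop := G_xi q `<=` G_xi p.

Lemma G_state_le_preorder : preorder Z G_state_le.
Proof.
split; first by move=> p.
by move=> p q r pq qr; exact: subset_trans qr pq.
Qed.

Lemma G_xi_top (p : Z) : G_xi p top.
Proof. by []. Qed.

Lemma G_xi_bot (p : Z) : ~ G_xi p bot.
Proof. by []. Qed.

Lemma G_xi_meet (p : Z) (J : Type) (a : J -> closed_lattice) :
  (forall i, G_xi p (a i)) <-> G_xi p (meet (range a)).
Proof.
split; first by move=> pa _ [i _ <-]; exact: pa.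
by move=> pm i; apply: pm; exists i.
Qed.

Lemma G_property_leE (A B : closed_lattice) :
  le A B <-> (forall r, G_xi r A -> G_xi r B).
Proof. by []. Qed.

Definition G_obj : state_property_system :=
  @StatePropertySystem Z G_state_le closed_lattice G_xi G_state_le_preorder
    G_xi_top G_xi_bot G_xi_meet (fun _ _ => iff_refl _) G_property_leE.
End GObj.

Definition preimage_closed (Z' Z : closure_space) (f : continuous_map Z' Z)
    (A : closed_subset Z) : closed_subset Z' :=
  exist _ (f @^-1` sval A) (cm_continuous f (svalP A)).

Definition G_map (Z' Z : closure_space) (f : continuous_map Z' Z) :
    sp_morphism (G_obj Z') (G_obj Z) :=
  @SPMorphism (G_obj Z') (G_obj Z) f (preimage_closed f)
    (fun _ _ => iff_refl _).

Lemma G_map_id (Z : closure_space) : G_map (cm_id Z) = sp_id (G_obj Z).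
Proof.
by apply: sp_morphism_eq => //; apply/funext => A; exact: closed_subset_eq.
Qed.

Lemma G_map_comp (X Y Z : closure_space)
    (g : continuous_map Y Z) (f : continuous_map X Y) :
  G_map (cm_comp g f) = sp_comp (G_map g) (G_map f).
Proof.
by apply: sp_morphism_eq => //; apply/funext => A; exact: closed_subset_eq.
Qed.

Definition G : functor Cls SP := @Functor Cls SP G_obj G_map G_map_id G_map_comp.

(* Main.v *)
(** A state property system is recovered from the closed sets [kappa a]: the
    map [kappa] is injective because [property_leE] makes the order of the
    lattice the inclusion of the sets [kappa a]. Hence the [n]-component of a
    morphism is determined by its [m]-component, and all the naturality and
    isomorphism equations reduce to identities between maps of states, where
    the unit and the counit are both the identity. *)
From Stdlib Require Import Relation_Definitions.
From mathcomp Require Import ssreflect ssrfun ssrbool.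
From mathcomp Require Import boolp classical_sets.
Require Import Defs.

Set Implicit Arguments.
Unset Strict Implicit.
Unset Printing Implicit Defensive.

Local Open Scope classical_set_scope.

Lemma kappa_inj (S : state_property_system) : injective (@kappa S).
Proof.
move=> a b kab; apply: (ord_antisym _ _ (le_order (property S))).
- by apply/property_leE => r; rewrite -[xi r a]/(kappa a r) kab.
- by apply/property_leE => r; rewrite -[xi r b]/(kappa b r) -kab.
Qed.

(** By [sp_mn], [kappa (sp_n f a)] is the preimage of [kappa a] under [sp_m f], so injectivity of
    [kappa] recovers [sp_n f]. *)
Lemma sp_morphism_eq_m (S' S : state_property_system) (f g : sp_morphism S' S) :
  sp_m f = sp_m g -> f = g.
Proof.
move=> fg; apply: sp_morphism_eq => //; apply/funext => a; apply: kappa_inj.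
apply/seteqP; split=> p /= pa; apply/sp_mn; move/sp_mn: pa.
- by rewrite fg.
- by rewrite -fg.
Qed.

(** Since [cl [set x]] is the least closed set containing [x], T0 means that closed sets separate
    points; for the closed sets [kappa a] this is injectivity of [xi]. *)
Lemma eq_cl1P (Z : closure_space) (x y : Z) :
  cl [set x] = cl [set y] <-> (forall A, closed_set Z A -> (A x <-> A y)).
Proof.
have cl1 z A : closed_set Z A -> A z -> cl [set z] `<=` A.
  by move=> cA Az; apply: cl_min => // _ ->.
split=> [exy A cA | xy].
- split=> [Ax | Ay].
  + by apply: (cl1 x A cA Ax); rewrite exy; apply: sub_cl.
  + by apply: (cl1 y A cA Ay); rewrite -exy; apply: sub_cl.
- apply/seteqP; split; apply: cl1; try exact: cl_closed.
  + by apply/xy; [exact: cl_closed | exact: sub_cl].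
  + by apply/xy; [exact: cl_closed | exact: sub_cl].
Qed.

Lemma T0_F_obj (S : state_property_system) : xi_injective S -> T0 (F_obj S).
Proof.
move=> xi_inj p q /eq_cl1P pq; apply: xi_inj; apply/seteqP.
by split=> a; apply: (pq (kappa a) _).1 || apply: (pq (kappa a) _).2; exists a.
Qed.

Lemma xi_injective_G_obj (Z : closure_space) : T0 Z -> xi_injective (G_obj Z).
Proof.
move=> T0Z p q pq; apply: T0Z; apply/eq_cl1P => A cA.
(* In [G_obj Z], membership of a point in a closed set is by definition membership of that set in
   [xi] of the point. *)
rewrite -[A p]/(@xi (G_obj Z) p (exist _ A cA)).
by rewrite -[A q]/(@xi (G_obj Z) q (exist _ A cA)) pq.
Qed.

Section Unit.
Variable S : state_property_system.

Definition closed_kappa (a : property S) : closed_subset (F_obj S) :=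
  exist _ (kappa a) (imageT (@kappa S) a).

(** A chosen preimage under [kappa], unique by [kappa_inj]. The unit needs this inverse because
    [sp_n] runs against [sp_m]. *)
Definition closed_property (A : closed_subset (F_obj S)) : property S :=
  sval (cid2 (svalP A)).

Lemma closed_propertyK (A : closed_subset (F_obj S)) :
  kappa (closed_property A) = sval A.
Proof. by rewrite /closed_property; case: cid2. Qed.

Lemma unit_subproof (A : property (G_obj (F_obj S))) (p : S) :
  @xi (G_obj (F_obj S)) p A <-> xi p (closed_property A).
Proof.
by rewrite -[xi p _]/(kappa (closed_property A) p) closed_propertyK.
Qed.

Definition unit_GF : sp_morphism S (G_obj (F_obj S)) :=
  @SPMorphism S (G_obj (F_obj S)) id closed_property unit_subproof.

Definition unit_GF_inv : sp_morphism (G_obj (F_obj S)) S :=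
  @SPMorphism (G_obj (F_obj S)) S id closed_kappa (fun _ _ => iff_refl _).

End Unit.

Section Counit.
Variable Z : closure_space.

(** In [G_obj Z], [kappa] of a closed set is that set itself. *)
Lemma closed_F_G : closed_set (F_obj (G_obj Z)) = closed_set Z.
Proof.
apply/seteqP; split=> A; first by case=> B _ <-; exact: (svalP B).
by move=> cA; exists (exist _ A cA).
Qed.

Lemma counit_subproof (A : set Z) :
  closed_set Z A -> closed_set (F_obj (G_obj Z)) (id @^-1` A).
Proof. by rewrite closed_F_G. Qed.

Lemma counit_inv_subproof (A : set Z) :
  closed_set (F_obj (G_obj Z)) A -> closed_set Z (id @^-1` A).
Proof. by rewrite closed_F_G. Qed.

Definition counit_FG : continuous_map (F_obj (G_obj Z)) Z :=
  @ContinuousMap (F_obj (G_obj Z)) Z id counit_subproof.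

Definition counit_FG_inv : continuous_map Z (F_obj (G_obj Z)) :=
  @ContinuousMap Z (F_obj (G_obj Z)) id counit_inv_subproof.

End Counit.

Theorem theorem7 :
  exists (F_SP0 : forall S : SP, xi_injective S -> T0 (F S))
         (G_Cls0 : forall Z : Cls, T0 Z -> xi_injective (G Z)),
    let F0 : functor SP0 Cls0 := restrict_functor F_SP0 in
    let G0 : functor Cls0 SP0 := restrict_functor G_Cls0 in
    establish_equivalence F0 G0.
Proof.
exists T0_F_obj, xi_injective_G_obj => F0 G0; split.
- have nat_unit (X Y : SP0) (f : hom X Y) :
      comp (unit_GF (sval Y) : @hom SP _ _) f =
      comp (fmap G (fmap F f)) (unit_GF (sval X) : @hom SP _ _).
    (* Both sides have state map [sp_m f], so the chosen preimages never need to be compared. *)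
    exact: sp_morphism_eq_m.
  exists (@NaturalTransformation _ _ (id_functor SP0) (comp_functor G0 F0)
    (fun X => unit_GF (sval X)) nat_unit).
  by move=> X; exists (unit_GF_inv (sval X)); split; exact: sp_morphism_eq_m.
- have nat_counit (X Y : Cls0) (f : hom X Y) :
      comp (counit_FG (sval Y) : @hom Cls _ _) (fmap F (fmap G f)) =
      comp (f : @hom Cls _ _) (counit_FG (sval X) : @hom Cls _ _).
    exact: continuous_map_eq.
  exists (@NaturalTransformation _ _ (comp_functor F0 G0) (id_functor Cls0)
    (fun Z => counit_FG (sval Z)) nat_counit).
  by move=> Z; exists (counit_FG_inv (sval Z)); split; exact: continuous_map_eq.
Qed.
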